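(* Let $(\mathcal{X},\Sigma,\{P_\theta\}_{\theta\in\Theta})$ be a statistical model and $\mu:\Sigma\to\overline{\mathbb{R}}$ a $\sigma$-finite measure such that $P_\theta\ll\mu$ for every $\theta\in\Theta$. Suppose that $(\mathcal{X},\Sigma)$ is an analytic Borel space. For each $\theta\in\Theta$, let $f_\theta:\mathcal{X}\to\mathbb{R}$ be a density of $P_\theta$ with respect to $\mu$. Let $(\mathcal{T},\Sigma_{\mathcal{T}})$ be a separable measurable space and $T:\mathcal{X}\to\mathcal{T}$ a measurable function. For any $x\in\mathcal{X}$ and $\Theta'\subseteq\Theta$, define $$D(x,\Theta'):=\big\{y\in\mathcal{X}:(\exists h_{xy}\in(0,\infty))(\forall\theta\in\Theta')\big(f_\theta(y)=f_\theta(x)h_{xy}\big)\big\}.$$ If $T$ is sufficient and there exists a non-empty countable subset $\Theta_0\subseteq\Theta$ such that, for any $x,y\in\mathcal{X}$ satisfying $y\in D(x,\Theta_0)$, we have $T(x)=T(y)$, then $T$ is minimal sufficient.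
   Context: A statistical model is a triple $(\mathcal{X},\Sigma,\{P_\theta\}_{\theta\in\Theta})$ with $(\mathcal{X},\Sigma)$ a measurable space, $\Theta$ a non-empty set and each $P_\theta$ a probability measure on $(\mathcal{X},\Sigma)$. A statistic is a measurable function $T:\mathcal{X}\to\mathcal{T}$ into a measurable space $(\mathcal{T},\Sigma_{\mathcal{T}})$. $T$ is sufficient iff for each $E\in\Sigma$ there is a measurable $\kappa_E:\mathcal{T}\to\mathbb{R}$ such that for every $\theta\in\Theta$, $P_\theta(E\mid T)=\kappa_E(T)$ $P_\theta$-a.e. (where $P_\theta(E\mid T)$ is the conditional probability given $\sigma(T)$). $T$ is minimal sufficient iff it is sufficient and, for every measurable space $(\mathcal{S},\Sigma_{\mathcal{S}})$ and every sufficient statistic $S:\mathcal{X}\to\mathcal{S}$, there is a measurable $f:\mathcal{S}\to\mathcal{T}$ such that for each $\theta\in\Theta$, $T=f(S)$ $P_\theta$-a.e. A density of $P_\theta$ with respect to $\mu$ is a Radon--Nikodym derivative $dP_\theta/d\mu$ (a particular version, defined at every point). A measurable space is countably generated iff its $\sigma$-algebra is generated by a countable collection of measurable sets; it is separable iff it is countably generated and every singleton is measurable. A standard Borel space is a measurable space whose $\sigma$-algebra is the Borel $\sigma$-algebra of a complete separable metric space. A measurable space $(\mathcal{X},\Sigma)$ is analytic Borel iff it is separable and there exist a standard Borel space $(\mathcal{Y},\Sigma_{\mathcal{Y}})$ and a surjective measurable function $\mathcal{Y}\to\mathcal{X}$. *)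

(* Defs.v *)
From HB Require Import structures.
From mathcomp Require Import all_boot all_order all_algebra.
From mathcomp Require Import all_classical all_reals all_analysis.
Import numFieldNormedType.Exports.

Set Implicit Arguments.
Unset Strict Implicit.
Unset Printing Implicit Defensive.
Import Order.TTheory GRing.Theory Num.Theory.

Local Open Scope classical_set_scope.
Local Open Scope ring_scope.

Definition countably_generated d (X : measurableType d) : Prop :=
  exists G : set (set X),
    [/\ countable G, G `<=` measurable & @measurable d X = <<s G >>].

Definition separable_measurable d (X : measurableType d) : Prop :=
  countably_generated X /\ forall x : X, measurable [set x].

(* Completeness is the axiom of [completeType], stated without a point of [M]
   since a [metricType] is not pointed. *)
Definition complete_separable (R : realType) (M : metricType R) : Prop :=
  (forall F : set_system M, ProperFilter F -> cauchy F -> exists l : M, F --> l) /\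
  (exists D : set M, countable D /\ dense D).

(* The metric structure [m] is put on the carrier of [Y] itself, so that the
   two sigma-algebras can be compared by an equality. *)
Definition standard_borel (R : realType) d (Y : measurableType d) : Prop :=
  exists m : Metric R Y,
    let M : metricType R := Metric.Pack m in
    complete_separable M /\ @measurable d Y = <<s @open M >>.

Definition analytic_borel (R : realType) d (X : measurableType d) : Prop :=
  separable_measurable X /\
  exists (d' : measure_display) (Y : measurableType d') (g : {mfun Y >-> X}),
    standard_borel R Y /\ (forall x : X, exists y : Y, g y = x).

(* [f] is a version of the Radon-Nikodym derivative dP/dmu; it is nonnegative
   mu-almost everywhere, but not assumed to be so everywhere. *)
Definition is_density (R : realType) d (X : measurableType d)
    (mu : {measure set X -> \bar R}) (P : probability X R) (f : X -> R) : Prop :=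
  mu.-integrable [set: X] (EFin \o f) /\
  forall A, measurable A -> P A = (\int[mu]_(x in A) (f x)%:E)%E.

(* [g] is a version of the conditional probability P(E | T), the conditioning
   being on the sigma-algebra generated by [T]. *)
Definition is_cond_prob (R : realType) d d' (X : measurableType d)
    (U : measurableType d') (P : probability X R) (T : X -> U)
    (E : set X) (g : X -> R) : Prop :=
  [/\ measurable_fun setT (g : g_sigma_algebra_preimageType T -> R),
      P.-integrable [set: X] (EFin \o g) &
      forall A, g_sigma_algebra_preimage T A ->
        (\int[P]_(x in A) (g x)%:E)%E = P (E `&` A)].

Definition sufficient (R : realType) d d' (X : measurableType d)
    (U : measurableType d') (Theta : Type) (P : Theta -> probability X R)
    (T : {mfun X >-> U}) : Prop :=
  forall E : set X, measurable E ->
    exists2 kappa : U -> R, measurable_fun setT kappa &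
      forall theta, exists2 g : X -> R,
        is_cond_prob (P theta) T E g & g = kappa \o T %[ae P theta].

Definition minimal_sufficient (R : realType) d d' (X : measurableType d)
    (U : measurableType d') (Theta : Type) (P : Theta -> probability X R)
    (T : {mfun X >-> U}) : Prop :=
  sufficient P T /\
  forall (ds : measure_display) (V : measurableType ds) (S : {mfun X >-> V}),
    sufficient P S ->
    exists2 f : V -> U, measurable_fun setT f &
      forall theta, T = f \o S %[ae P theta].

Definition density_class (R : realType) (X Theta : Type) (f : Theta -> X -> R)
    (x : X) (Theta' : set Theta) : set X :=
  [set y | exists2 h : R, 0 < h &
    forall theta, Theta' theta -> f theta y = f theta x * h].

(* Main.v *)
Require Import Defs.
From HB Require Import structures.
From mathcomp Require Import all_boot all_order all_algebra.
From mathcomp Require Import all_classical all_reals all_analysis.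
From mathcomp Require Import measurable_realfun zify.

Set Implicit Arguments.
Unset Strict Implicit.
Unset Printing Implicit Defensive.
Import numFieldNormedType.Exports.
Import Order.TTheory GRing.Theory Num.Theory.

Local Open Scope classical_set_scope.
Local Open Scope ring_scope.

(** Let S be any other sufficient statistic; T must be exhibited as a measurable
    function of S, almost everywhere for all the P_theta at once.

    Domination yields countably many indices e_i such that an event null for
    every P_(e_i) is null for every P_theta ([countable_dominating_subfamily]);
    hence the mixture lam = sum_i 2^-(i+1) P_(e_i) dominates the whole family.
    Since the versions of P_theta(E | S) can be chosen independent of theta, they
    are also versions of lam(E | S), and this forces dP_theta/dlam to be a
    function of S.  With h = dlam/dmu one gets f_theta = g_theta(S) h off a
    lam-null set, with h > 0 ([density_factorization]).  Discarding one null set Z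
    for the countably many theta in Theta_0, two points x, y outside Z with
    g_theta(S x) = g_theta(S y) for all these theta have proportional densities,
    with ratio h y / h x, so T x = T y.  Thus off Z the value of T is determined
    by the countably many events g_theta(S) < r with r rational.

    What remains is the measurability of the map phi with T = phi(S), and this is
    where X being analytic enters ([analytic_factorization]).  Record for each x
    the bits telling which of the events defining T, S and Z contain x.  For an
    analytic X, the bit sequences so obtained are read off a closed set F of
    sequences of integers at fixed coordinates ([analytic_parametrization]).
    Choquet's capacitability argument provides, for each c < 1, a bound b such
    that the part of F below b, which is compact, still accounts for a set of x
    of probability at least c ([capacitability]).  For a compact piece of F,
    membership of v in the relevant subset of V is tested by finitely many
    coordinates at a time, so that all sets involved are countable intersections
    of measurable ones ([measurable_compact_trace]).  Countably
    many such pieces carry almost every x; phi is read off them, and is constant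
    on the measurable set of those v that no piece reaches.  Its values lie in U
    itself, because every bit sequence in F comes from a point of X. *)

(** * Closed sets of integer sequences *)

Section ClosedSets.
Context {I : eqType}.
Implicit Types (F : set (I -> nat)) (s : I -> nat).

(** Closedness in the product of discrete copies of nat: a sequence belongs to F
    as soon as each of its finite restrictions extends to an element of F. *)
Definition seq_closed F := forall s,
  (forall l : seq I, exists2 s', F s' & {in l, s' =1 s}) -> F s.

Lemma seq_closed_const (Q : Prop) : seq_closed [set _ | Q].
Proof. by move=> s /(_ [::]) [s' + _]. Qed.

Lemma seq_closed_forall (A : Type) (F : A -> set (I -> nat)) :
  (forall a, seq_closed (F a)) -> seq_closed [set s | forall a, F a s].
Proof.
move=> cF s Hs a; apply: cF => l.
by have [s' Fs' e] := Hs l; exists s' => //; exact: Fs'.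
Qed.

Lemma seq_closedI F G : seq_closed F -> seq_closed G -> seq_closed (F `&` G).
Proof.
move=> cF cG s Hs; split; [apply: cF|apply: cG] => l;
  by have [s' [Fs' Gs'] e] := Hs l; exists s'.
Qed.

(** The coordinate i is locally constant, so a closed condition may depend on its
    value: this is how existential witnesses stored in a coordinate are used. *)
Lemma seq_closed_switch (i : I) (F : nat -> set (I -> nat)) :
  (forall n, seq_closed (F n)) -> seq_closed [set s | F (s i) s].
Proof.
move=> cF s Hs; apply: cF => l.
have [s' Fs' e] := Hs (i :: l); exists s'.
  by move: Fs' => /=; rewrite e// mem_head.
by move=> j jl; apply: e; rewrite inE jl orbT.
Qed.

Lemma seq_closed_at (i : I) (Q : nat -> Prop) : seq_closed [set s | Q (s i)].
Proof.
by apply: (@seq_closed_switch i (fun n => [set _ | Q n])) => n; exact: seq_closed_const.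
Qed.

End ClosedSets.

Lemma seq_closed_reindex (I J : eqType) (r : J -> I) (F : set (J -> nat)) :
  seq_closed F -> seq_closed [set s : I -> nat | F (s \o r)].
Proof.
move=> cF s Hs; apply: cF => l.
have [s' Fs' e] := Hs (map r l); exists (s' \o r) => //= j jl.
by apply: e; exact: map_f.
Qed.

(** Compactness of the product of the intervals [0, b i]: along an ultrafilter
    finer than the Frechet filter each coordinate, having finitely many values, is
    eventually constant, and these constants form the limit s. *)
Lemma bounded_subsequence (b : nat -> nat) (a : nat -> nat -> nat) :
  (forall j i, (i < j)%N -> (a j i <= b i)%N) ->
  exists2 s : nat -> nat, (forall i, (s i <= b i)%N) &
    forall k, exists2 j, (k <= j)%N & forall i, (i < k)%N -> a j i = s i.
Proof.
move=> ab.
have [U [UU ooU]] := @ultraFilterLemma _ (@nbhs nat (set_system nat) \oo) _.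
have ge k : U [set j | (k <= j)%N] by apply: ooU; exists k.
have val i : {v | (v <= b i)%N /\ U [set j | a j i = v]}.
  apply: cid; apply: contrapT => /forallNP nv.
  have low n : (n <= (b i).+1)%N -> U [set j | (n <= a j i)%N].
    elim: n => [_|n IH nb].
      by apply: filterS (@filterT _ U _) => j.
    have [H|H] := @in_ultra_setVsetC _ U [set j | a j i = n] _.
    - by case: (nv n).
    apply: filterS (filterI (IH (ltnW nb)) H) => j /= [nj /eqP]; lia.
  have [j /= [h1 /ab h2]] := filter_ex (filterI (low _ (leqnn _)) (ge i.+1)).
  lia.
exists (fun i => sval (val i)) => [i|k]; first by have [] := svalP (val i).
have Uk : U [set j | forall i, (i < k)%N -> a j i = sval (val i)].
  elim: k => [|k IH]; first by apply: filterS (@filterT _ U _) => j.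
  have [_ Hk] := svalP (val k).
  apply: filterS (filterI IH Hk) => j /= [h1 h2] i.
  by rewrite ltnS leq_eqVlt => /predU1P[->//|]; exact: h1.
by have [j /= [? ?]] := filter_ex (filterI Uk (ge k)); exists j.
Qed.

(** Koenig's lemma for the compact part of F below b: a pattern c is realised at
    the coordinates q as soon as each finite part of it is, even when the bound b
    is only imposed on finitely many coordinates at a time. *)
Lemma seq_closed_compact (F : set (nat -> nat)) (b : nat -> nat) (q : nat -> nat)
    (c : nat -> nat) : seq_closed F ->
  (forall k, exists2 s, F s & (forall i, (i < k)%N -> (s i <= b i)%N) /\
      forall i, (i < k)%N -> s (q i) = c i) ->
  exists2 s, F s & (forall i, (s i <= b i)%N) /\ forall i, s (q i) = c i.
Proof.
move=> cF wit; have /choice[a Ha] : forall k, exists s, [/\ F s,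
    forall i, (i < k)%N -> (s i <= b i)%N & forall i, (i < k)%N -> s (q i) = c i].
  by move=> k; have [s Fs [? ?]] := wit k; exists s.
have [|s sb Hs] := @bounded_subsequence b a.
  by move=> j i ij; have [_ + _] := Ha j; exact.
exists s.
  apply: cF => l; pose k := (\max_(i <- l) i).+1.
  have [j _ e] := Hs k; exists (a j); first by have [] := Ha j.
  by move=> i il; apply: e; rewrite ltnS; exact: leq_bigmax_seq.
split=> // i; have [j kj e] := Hs (maxn (q i) i).+1.
rewrite -e ?ltnS ?leq_maxl//; have [_ _] := Ha j; apply.
by apply: leq_trans kj; rewrite ltnS leq_maxr.
Qed.
(** * Coding a Polish space by integer sequences *)

Section Codes.
Context {R : realType} {M : metricType R} (e : nat -> M).
Hypothesis e_dense : forall (y : M) (r : R), 0 < r -> exists n, mdist (e n) y < r.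
Implicit Types (y : M) (s t : nat -> nat).

Let rad (k : nat) : R := k.+1%:R^-1.
Let rad_gt0 k : 0 < rad k. Proof. by rewrite invr_gt0. Qed.

Let rad_small (r : R) : 0 < r -> exists k, rad k < r.
Proof.
move=> r0; have [k _ kr] := near_infty_natSinv_lt (PosNum r0).
by exists k; apply: kr => /=.
Qed.

(** A code lists, for each k, a point of the dense sequence e which is within
    1/(k+1) of y; open and closed conditions on y can be read off any code of y. *)
Definition code s y := forall k, mdist (e (s k)) y <= rad k.

Lemma code_exists y : exists s, code s y.
Proof.
have /choice[s Hs] : forall k, exists n, mdist (e n) y <= rad k.
  by move=> k; have [n /ltW] := e_dense y (rad_gt0 k); exists n.
by exists s.
Qed.

Definition consistent s :=
  forall k, exists y, forall j, (j < k)%N -> mdist (e (s j)) y <= rad j.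

Lemma seq_closed_consistent : seq_closed consistent.
Proof.
apply: seq_closed_forall => k s /(_ (iota 0 k)) [s' [y Hy] ss'].
by exists y => j jk; rewrite -ss' ?mem_iota//; exact: Hy.
Qed.

Lemma code_consistent s y : code s y -> consistent s.
Proof. by move=> Hs k; exists y. Qed.

(** Completeness: points meeting the first k constraints form a Cauchy sequence,
    and its limit meets all the constraints, which are closed. *)
Lemma consistent_code s :
  (forall F : set_system M, ProperFilter F -> cauchy F -> exists l : M, F --> l) ->
  consistent s -> exists y, code s y.
Proof.
move=> complete /choice[u Hu]; have [|l ul] := complete (u @ \oo) _.

  apply: cauchy_exP => r r0; have [j jr] := rad_small r0.
  exists (e (s j)); exists j.+1 => //= k /= jk.
  by rewrite ballEmdist/=; exact: le_lt_trans (Hu k j jk) jr.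
exists l => j; apply/ler_addgt0Pr => r r0.
have : \forall k \near \oo, mdist l (u k) < r.
  exact: metricType_numDomainType.cvgr_dist_lt.
move=> [N _ HN]; pose k := maxn N j.+1.
apply: (le_trans (metric_triangle _ (u k) _)).
rewrite lerD//; first by apply: Hu; rewrite leq_max leqnn orbT.
by rewrite metric_sym; apply/ltW/HN; rewrite /= leq_maxl.
Qed.

Definition join s t (i : nat + nat) :=
  match i with inl a => s a | inr b => t b end.

(** Analytic sets in normal form: y is in B when some integer sequence t, together
    with a code of y, lies in a closed set.  The equivalence is required for every
    code of y, so that several sets can be tested on one code. *)
Definition suslin (B : set M) := exists2 F : set (nat + nat -> nat),
  seq_closed F & forall s y, code s y -> (B y <-> exists t, F (join s t)).

(** The first coordinate of the witness names the set to which y belongs. *)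
Lemma suslin_bigcup (B : nat -> set M) :
  (forall n, suslin (B n)) -> suslin (\bigcup_n B n).
Proof.
move=> sB; have /choice[F HF] : forall n, exists F : set (nat + nat -> nat),
    seq_closed F /\ forall s y, code s y -> (B n y <-> exists t, F (join s t)).
  by move=> n; have [F] := sB n; exists F.
pose shift (i : nat + nat) : nat + nat :=
  match i with inl a => inl a | inr b => inr b.+1 end.
exists [set u : nat + nat -> nat | F (u (inr 0%N)) (u \o shift)].
  apply: (@seq_closed_switch (nat + nat)%type (inr 0%N)
    (fun n => [set u : nat + nat -> nat | F n (u \o shift)])) => n.
  by apply: seq_closed_reindex; have [] := HF n.
move=> s y sy; split=> [[n _ /((HF n).2 _ _ sy)[t Ft]]|[t /= Ft]].
  exists (fun k => if k is k'.+1 then t k' else n) => /=.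
  by congr (F _ _): Ft; apply/funext => -[].
exists (t 0%N) => //; apply/((HF _).2 _ _ sy); exists (t \o S).
by congr (F _ _): Ft; apply/funext => -[].
Qed.

(** A witness for the intersection interleaves one witness for each set. *)
Lemma suslin_bigcap (B : nat -> set M) :
  (forall n, suslin (B n)) -> suslin (\bigcap_n B n).
Proof.
move=> sB; have /choice[F HF] : forall n, exists F : set (nat + nat -> nat),
    seq_closed F /\ forall s y, code s y -> (B n y <-> exists t, F (join s t)).
  by move=> n; have [F] := sB n; exists F.
pose slice (n : nat) (i : nat + nat) : nat + nat :=
  match i with inl a => inl a | inr b => inr (pickle (n, b)) end.
exists [set u : nat + nat -> nat | forall n, F n (u \o slice n)].
  by apply: seq_closed_forall => n; apply: seq_closed_reindex; have [] := HF n.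
move=> s y sy; split=> [By|[t /= Ft] n _].
  have /choice[t Ht] : forall n, exists t, F n (join s t).
    by move=> n; apply/((HF n).2 _ _ sy); exact: By.
  exists (fun k => if unpickle k is Some (n, b) then t n b else 0%N) => n /=.
  by congr (F _ _): (Ht n); apply/funext => -[a//|b] /=; rewrite pickleK.
apply/((HF _).2 _ _ sy); exists (fun b => t (pickle (n, b))).
by congr (F _ _): (Ft n); apply/funext => -[].
Qed.

Let small_ball (B : set M) m n := [set z | mdist (e n) z <= rad m] `<=` B.

(** An open set contains y exactly when it contains one of the closed balls around
    the points of a code: a condition on a single coordinate of the code. *)
Let open_code B s y : open B -> code s y ->
  (B y <-> exists m, small_ball B m (s m)).
Proof.
move=> oB sy; split=> [By|[m]]; last by apply; exact: sy.
have /metricType_numDomainType.nbhs_mdistP[r /= r0 rB] : \near y, B y by exact: open_nbhs_nbhs.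
have [m mr] := rad_small (divr_gt0 r0 (ltr0n R 2)).
exists m => z /= zm; apply: rB => /=.
apply: (le_lt_trans (metric_triangle _ (e (s m)) _)).
rewrite [r]splitr ltrD//; last exact: le_lt_trans zm mr.
by rewrite metric_sym; exact: le_lt_trans (sy m) mr.
Qed.

(** Closed under complement by its form, and under countable unions by
    [suslin_bigcup] and [suslin_bigcap]: the sets of this kind form a
    sigma-algebra, so that they include the Borel sets once they include the
    open sets. *)
Definition bisuslin (B : set M) := suslin B /\ suslin (~` B).

Lemma bisuslin_open B : open B -> bisuslin B.
Proof.
move=> oB; split.
- exists [set u : nat + nat -> nat | small_ball B (u (inr 0%N)) (u (inl (u (inr 0%N))))].
    apply: (@seq_closed_switch (nat + nat)%type (inr 0%N)
      (fun m => [set u : nat + nat -> nat | small_ball B m (u (inl m))])) => m.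
    exact: (@seq_closed_at _ (inl m) (small_ball B m)).
  move=> s y sy; split=> [/(open_code oB sy)[m Hm]|[t /= Ht]].
    by exists (fun=> m).
  by apply/(open_code oB sy); exists (t 0%N).
- exists [set u : nat + nat -> nat | forall m, ~ small_ball B m (u (inl m))].
    apply: seq_closed_forall => m.
    exact: (@seq_closed_at _ (inl m) (fun n => ~ small_ball B m n)).
  move=> s y sy; split=> [nBy|[t /= Ht] By].
    by exists s => m Hm; apply/nBy/(open_code oB sy); exists m.
  by have [m Hm] := (open_code oB sy).1 By; exact: (Ht m).
Qed.

Lemma bisuslin_borel B : <<s @open M >> B -> bisuslin B.
Proof.
apply; split; last by move=> C; exact: bisuslin_open.
split=> [|C [sC nC]|C sC].
- by apply: bisuslin_open; exact: open0.
- by split; rewrite setTD// setCK.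
- split; first by apply: suslin_bigcup => n; have [] := sC n.
  by rewrite setC_bigcup; apply: suslin_bigcap => n; have [] := sC n.
Qed.

(** A sequence in F carries a code of a point y, one bit for each k, and a witness
    that the bit correctly tells whether y is in B k.  Consequently the bits, which
    sit at the coordinates q, are continuous functions on F although the B k are
    arbitrary Borel sets. *)
Lemma borel_parametrization (B : nat -> set M) :
  (forall F : set_system M, ProperFilter F -> cauchy F -> exists l : M, F --> l) ->
  (forall k, <<s @open M >> (B k)) ->
  exists F : set (nat -> nat), exists q : nat -> nat, [/\ seq_closed F,
    forall y, exists2 s, F s & forall k, s (q k) = `[< B k y >] &
    forall s, F s -> exists y, forall k, s (q k) = `[< B k y >]].
Proof.
move=> complete bB.
have /choice[P HP] : forall k, exists P : set (nat + nat -> nat),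
    seq_closed P /\ forall s y, code s y -> (B k y <-> exists t, P (join s t)).
  by move=> k; have [[P]] := bisuslin_borel (bB k); exists P.
have /choice[N HN] : forall k, exists N : set (nat + nat -> nat),
    seq_closed N /\ forall s y, code s y -> (~ B k y <-> exists t, N (join s t)).
  by move=> k; have [_ [N]] := bisuslin_borel (bB k); exists N.
pose I : Type := (nat + nat + nat * nat)%type.
pose code_at (i : nat) : I := inl (inl i).
pose bit_at (i : nat) : I := inl (inr i).
pose wit_at (k : nat) (i : nat + nat) : I :=
  match i with inl a => code_at a | inr b => inr (k, b) end.
(* The bit at k selects which of the two closed sets its witness must meet. *)
pose G (u : I -> nat) := consistent (u \o code_at) /\ forall k,
  match u (bit_at k) with
  | 0 => N k (u \o wit_at k) | 1 => P k (u \o wit_at k) | _ => False end.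
have cG : @seq_closed I G.
  apply: seq_closedI.
    exact: (seq_closed_reindex (r := code_at) seq_closed_consistent).
  apply: seq_closed_forall => k; apply: (@seq_closed_switch I (bit_at k)
    (fun n => [set u : I -> nat | match n with
      | 0 => N k (u \o wit_at k) | 1 => P k (u \o wit_at k) | _ => False end])).
  case=> [|[|n]]; last exact: seq_closed_const.
    by apply: seq_closed_reindex; have [] := HN k.
  by apply: seq_closed_reindex; have [] := HP k.
exists [set s : nat -> nat | G (s \o pickle)], (fun k => pickle (bit_at k)); split.
- exact: seq_closed_reindex.
- move=> y; have [s sy] := code_exists y.
  have /choice[t Ht] : forall k, exists t,
      if `[< B k y >] then P k (join s t) else N k (join s t).
    move=> k; case: asboolP => By; first exact/((HP k).2 _ _ sy).
    exact/((HN k).2 _ _ sy).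
  pose u (i : I) : nat := match i with
    | inl (inl a) => s a | inl (inr k) => `[< B k y >] | inr (k, b) => t k b end.
  have Gu : G u.
    split=> [|k]; first exact: code_consistent sy.
    have -> : u \o wit_at k = join s (t k) by apply/funext => -[].
    by move: (Ht k); rewrite /u/=; case: asboolP.
  exists (fun n => if unpickle n is Some i then u i else 0%N).
    by congr G : Gu; apply/funext => i /=; rewrite pickleK.
  by move=> k; rewrite pickleK.
- move=> s [/(consistent_code complete)[y sy] Gs]; exists y => k.
  have joinE : (s \o pickle) \o wit_at k =
      join (s \o pickle \o code_at) (fun b => s (pickle (inr (k, b) : I))).
    by apply/funext => -[].
  move: (Gs k); rewrite joinE /=; case: (s _) => [|[|//]] H.
    by case: asboolP => // By; have := ((HN k).2 _ _ sy).2 (ex_intro _ _ H).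
  by case: asboolP => // -[]; apply/((HP k).2 _ _ sy); eexists; exact: H.
Qed.

End Codes.
(** * Compact traces and capacitability *)

Lemma countable_enum (T : Type) (D : set T) : countable D -> D !=set0 ->
  exists e : nat -> T, (forall n, D (e n)) /\ forall x, D x -> exists n, e n = x.
Proof.
move=> /countable_injP[f finj] [x0 Dx0].
have /choice[e He] : forall n, exists x, D x /\ ((exists2 y, D y & f y = n) -> f x = n).
  move=> n; have [[y Dy fy]|nex] := pselect (exists2 y, D y & f y = n).
    by exists y.
  by exists x0; split => // -[y Dy fy]; case: nex; exists y.
exists e; split=> [n|x Dx]; first by have [] := He n.
have [De fe] := He (f x); exists (f x); apply: finj; rewrite ?inE//.
by apply: fe; exists x.
Qed.

(** The bit sequences of an analytic space are those of the Polish space mapped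
    onto it, for the preimages of the given sets. *)
Lemma analytic_parametrization (R : realType) d (X : measurableType d)
    (C : nat -> set X) : analytic_borel R X -> (forall k, measurable (C k)) ->
  exists F : set (nat -> nat), exists q : nat -> nat, [/\ seq_closed F,
    forall x, exists2 s, F s & forall k, s (q k) = `[< C k x >] &
    forall s, F s -> exists x, forall k, s (q k) = `[< C k x >]].
Proof.
move=> [_ [d' [Y [g [[m]]]]]]; set M := Metric.Pack m.
move=> /= [[complete [D [cD dD]]] YE] gsurj mC.
have [e [De eD]] : exists e : nat -> M,
    (forall n, D (e n)) /\ forall x, D x -> exists n, e n = x.
  apply: countable_enum => //; have [||y [_ Dy]] := dD setT; last by exists y.
    by exists (@point Y).
  exact: openT.
have e_dense (y : M) (r : R) : 0 < r -> exists n, mdist (e n) y < r.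
  move=> r0; have [||z [zy Dz]] := dD (interior (ball y r)).
  - by exists y; exact: nbhsx_ballx.
  - exact: open_interior.
  have [n ez] := eD _ Dz; exists n; rewrite ez metric_sym.
  by have := interior_subset zy; rewrite ballEmdist.
have [|F [q [cF FY YF]]] := @borel_parametrization R M e e_dense
    (fun k => g @^-1` C k) complete.
  by move=> k; rewrite -YE -[X in measurable X]setTI; exact: measurable_funP.
exists F, q; split=> // [x|s /YF[y Hy]]; last by exists (g y).
by have [y <-] := gsurj x; have [s Fs Hs] := FY y; exists s.
Qed.

Section CompactTraces.
Context d (X : measurableType d) (C : nat -> set X).
Hypothesis mC : forall k, measurable (C k).
Implicit Types (F : set (nat -> nat)) (q b : nat -> nat).

(** Any condition on finitely many bits, however wild Q is, defines a finite
    Boolean combination of the C i. *)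
Lemma measurable_finite_pattern k (Q : (nat -> bool) -> Prop) :
  measurable [set x | Q (fun i => (i < k)%N && `[< C i x >])].
Proof.
elim: k Q => [|k IH] Q.
  have [Q0|nQ0] := pselect (Q (fun=> false)).
    by rewrite [X in measurable X](_ : _ = setT) //; apply/seteqP; split => x _.
  by rewrite [X in measurable X](_ : _ = set0) //; apply/seteqP; split.
pose ext (v : bool) (w : nat -> bool) i := if i == k then v else w i.
rewrite (_ : [set x | _] =
  (C k `&` [set x | Q (ext true (fun i => (i < k)%N && `[< C i x >]))]) `|`
  (~` C k `&` [set x | Q (ext false (fun i => (i < k)%N && `[< C i x >]))])).
  apply: measurableU; apply: measurableI => //; first exact: (IH (Q \o ext true)).
    exact: measurableC.
  exact: (IH (Q \o ext false)).
have extE x : (fun i => (i < k.+1)%N && `[< C i x >]) =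
    ext `[< C k x >] (fun i => (i < k)%N && `[< C i x >]).
  apply/funext => i; rewrite /ext; case: eqVneq => [->|ik]; first by rewrite ltnSn.
  by rewrite ltnS leq_eqVlt (negbTE ik).
apply/seteqP; split => x /=; rewrite extE.
  by case: asboolP => Ckx; [left|right].
by case: asboolP => Ckx [[]|[]].
Qed.

(** The points whose bits are carried by the compact part of F below b. *)
Definition compact_trace F q b := [set x | exists2 s, F s &
  (forall i, (s i <= b i)%N) /\ forall i, s (q i) = `[< C i x >]].

(** Only the coordinates below k are constrained, so that this depends on finitely
    many bits; compactness makes the trace the intersection over k. *)
Let approx_trace F q b k := [set x | exists2 s, F s &
  (forall i, (i < k)%N -> (s i <= b i)%N) /\
  forall i, (i < k)%N -> s (q i) = `[< C i x >]].

Let measurable_approx_trace F q b k : measurable (approx_trace F q b k).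
Proof.
have := measurable_finite_pattern k (fun w => exists2 s, F s &
  (forall i, (i < k)%N -> (s i <= b i)%N) /\
  forall i, (i < k)%N -> s (q i) = w i).
congr (measurable _); apply/seteqP.
by split => x [s Fs [sb sC]]; exists s => //; split=> // i ik; rewrite sC// ik.
Qed.

Let approx_traceS F q b m n : (m <= n)%N ->
  approx_trace F q b n `<=` approx_trace F q b m.
Proof.
move=> mn x [s Fs [sb sC]]; exists s => //.
by split=> i im; [apply: sb|apply: sC]; exact: leq_trans im mn.
Qed.

Let compact_traceE F q b : seq_closed F ->
  compact_trace F q b = \bigcap_k approx_trace F q b k.
Proof.
move=> cF; apply/seteqP; split => [x [s Fs [sb sC]] k _|x Hx]; first by exists s.
by apply: seq_closed_compact => // k; exact: Hx.
Qed.

Lemma measurable_compact_trace F q b : seq_closed F ->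
  measurable (compact_trace F q b).
Proof.
by move=> cF; rewrite compact_traceE//; exact: bigcapT_measurable.
Qed.

Context {R : realType} (lam : {measure set X -> \bar R}).

(** For a finite measure, this says that the outer measure of A exceeds c. *)
Definition thick (c : \bar R) (A : set X) :=
  forall B, measurable B -> A `<=` B -> (c < lam B)%E.

(** Outer measure is continuous along increasing sequences of arbitrary sets: if
    each A n had a measurable superset B n of measure at most c, then so would the
    union, namely the lower limit of the B n. *)
Lemma thick_bigcup (c : \bar R) (A : nat -> set X) :
  (forall m n, (m <= n)%N -> A m `<=` A n) -> thick c (\bigcup_n A n) ->
  exists n, thick c (A n).
Proof.
move=> Amono tA; apply: contrapT => /forallNP nt.
have /choice[B HB] : forall n, exists B, [/\ measurable B, A n `<=` B & (lam B <= c)%E].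
  move=> n; have /existsNP[B /not_implyP[mB /not_implyP[AB /negP]]] := nt n.
  by rewrite -leNgt => Bc; exists B.
have mB n : measurable (B n) by have [] := HB n.
pose G n := \bigcap_(i in [set i | (n <= i)%N]) B i.
have mG n : measurable (G n) by exact: bigcap_measurableType.
have mUG : measurable (\bigcup_n G n) by exact: bigcupT_measurable.
have : (c < lam (\bigcup_n G n))%E.
  apply: tA => // x [n _ Anx]; exists n => // i /= ni.
  by have [_ + _] := HB i; apply; exact: Amono Anx.
have G_nd : nondecreasing_seq G.
  move=> m n mn; rewrite subsetEset => x Gx i /= ni.
  by apply: Gx => /=; exact: leq_trans ni.
have cvgG := nondecreasing_cvg_mu (mu := lam) mG mUG G_nd.
apply/negP; rewrite -leNgt -(cvg_lim _ cvgG)//.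
apply: lime_le; first by apply/cvg_ex; eexists; exact: cvgG.
apply: nearW => n /=; have [_ _] := HB n; apply: le_trans.
by apply: le_measure; rewrite ?inE// => x; apply => /=.
Qed.

(** Choquet's argument: bounding the coordinates of F one after the other, the
    bound on the next coordinate can be taken so large that the points still
    represented have outer measure above c.  The sets [approx_trace F q b k]
    contain these points and decrease to the compact trace. *)
Lemma capacitability (c : \bar R) F q : seq_closed F ->
  (lam setT < +oo)%E ->
  thick c [set x | exists2 s, F s & forall i, s (q i) = `[< C i x >]] ->
  exists b, (c <= lam (compact_trace F q b))%E.
Proof.
move=> cF lamT tF.
pose E (p : seq nat) := [set x | exists2 s, F s &
  (forall i, (i < size p)%N -> (s i <= nth 0 p i)%N) /\
  forall i, s (q i) = `[< C i x >]].
have /choice[phi Hphi] : forall p, exists n, thick c (E p) -> thick c (E (rcons p n)).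
  move=> p; have [tp|ntp] := pselect (thick c (E p)); last by exists 0%N.
  have [||n tn] := @thick_bigcup c (fun n => E (rcons p n)); last by exists n.
  - move=> m n mn x [s Fs [sp sC]]; exists s => //; split=> // i.
    rewrite size_rcons => ip; apply: leq_trans (sp i _) _; rewrite ?size_rcons//.
    by rewrite !nth_rcons; case: ltnP => // pi; case: eqP.
  - move=> B mB AB; apply: tp => // x [s Fs [sp sC]]; apply: AB.
    exists (s (size p)) => //; exists s => //; split=> // i.
    rewrite size_rcons ltnS leq_eqVlt nth_rcons => /predU1P[->|ip].
      by rewrite ltnn eqxx.
    by rewrite ip; exact: sp.
pose pre k := iter k (fun p => rcons p (phi p)) [::].
have tpre k : thick c (E (pre k)).
  elim: k => [|k IH]; last exact: Hphi.
  move=> B mB EB; apply: tF => // x [s Fs sC]; apply: EB.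
  by exists s.
have size_pre k : size (pre k) = k by elim: k => //= k IH; rewrite size_rcons IH.
pose b i := nth 0%N (pre i.+1) i.
have preE k i : (i < k)%N -> nth 0%N (pre k) i = b i.
  elim: k => // k IH; rewrite ltnS leq_eqVlt => /predU1P[->//|ik].
  by rewrite /= nth_rcons size_pre ik IH.
exists b; rewrite compact_traceE//.
have D0 : (lam (approx_trace F q b 0) < +oo)%E.
  by apply: le_lt_trans lamT; apply: le_measure; rewrite ?inE.
have mD : measurable (\bigcap_k approx_trace F q b k) by exact: bigcapT_measurable.
have D_ni : nonincreasing_seq (approx_trace F q b).
  by move=> m n mn; rewrite subsetEset; exact: approx_traceS.
have cvgD := nonincreasing_cvg_mu D0 (measurable_approx_trace F q b) mD D_ni.
rewrite -(cvg_lim _ cvgD)//; apply: lime_ge.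
  by apply/cvg_ex; eexists; exact: cvgD.
apply: nearW => k; apply/ltW/tpre => // x [s Fs [sp sC]].
exists s => //; split=> // i ik; rewrite -(preE _ _ ik).
by apply: sp; rewrite size_pre.
Qed.

End CompactTraces.

(** * Countable mixtures and restricted images of measures *)

Section Mixture.
Context d (X : measurableType d) (R : realType) (P : nat -> probability X R).

Let weight (i : nat) : {nonneg R} := (1 / (2 ^ (i + 1))%:R)%:nng.

Let mscaleE i A :
  mscale (weight i) (P i) A = ((1 / (2 ^ (i + 1))%:R)%:E * P i A)%E.
Proof. by []. Qed.

Definition mixture : set X -> \bar R :=
  mseries (fun i => mscale (weight i) (P i)) 0.

HB.instance Definition _ := Measure.on mixture.

Let mixture_setT : mixture [set: X] = 1%E.
Proof.
have /(cvg_lim _) := @cvg_geometric_eseries_half R 1 0.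
rewrite expr0 divr1 => <- //; rewrite /mixture /mseries; congr (limn _).
apply/funext => n; apply: eq_bigr => i _.
by have := mscaleE i setT; rewrite probability_setT mule1.
Qed.

HB.instance Definition _ := Measure_isProbability.Build _ _ _ mixture mixture_setT.

Lemma mixture_null A : mixture A = 0%E <-> forall i, P i A = 0%E.
Proof.
split=> [mA0 i|PA0]; last first.
  by apply: eseries0 => i _ _; have := mscaleE i A; rewrite PA0 mule0.
have term0 j : (0 <= mscale (weight j) (P j) A)%E by exact: measure_ge0.
have : (mscale (weight i) (P i) A <= 0)%E.
  rewrite -mA0 /mixture /mseries (@nneseriesD1 _ _ i)// leeDl//.
  exact: nneseries_ge0.
rewrite mscaleE pmule_rle0 ?lte_fin ?divr_gt0 ?ltr0n ?expn_gt0//= => PA.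
by apply/eqP; rewrite eq_le PA measure_ge0.
Qed.
End Mixture.

Section ImageOfRestriction.
Context d (X : measurableType d) d' (V : measurableType d') (R : realType).
Variables (lam : probability X R) (S : {mfun X >-> V}) (E : set X).
Hypothesis mE : measurable E.

(** The measure B |-> lam (E and S in B) on V, whose density with respect to the
    law of S is the conditional probability of E given S. *)
Definition image_restr : set V -> \bar R := pushforward (mrestr lam mE) S.

Let image_restr0 : image_restr set0 = 0%E.
Proof. exact: measure0. Qed.

Let image_restr_ge0 A : (0 <= image_restr A)%E.
Proof. exact: measure_ge0. Qed.

Let image_restr_sigma_additive : semi_sigma_additive image_restr.
Proof. exact: measure_semi_sigma_additive. Qed.

HB.instance Definition _ := isMeasure.Build _ _ _ image_restr
  image_restr0 image_restr_ge0 image_restr_sigma_additive.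

Let image_restr_fin : fin_num_fun image_restr.
Proof.
by move=> A mA; apply: fin_num_measure;
  rewrite -[X in measurable X]setTI; exact: measurable_funP.
Qed.

HB.instance Definition _ := Measure_isFinite.Build _ _ _ image_restr image_restr_fin.

Lemma ge0_integral_image_restr (g : V -> \bar R) : measurable_fun [set: V] g ->
  (forall v, 0 <= g v)%E ->
  (\int[image_restr]_v g v = \int[lam]_(x in E) g (S x))%E.
Proof.
move=> mg g0; have mgS : measurable_fun [set: X] (g \o S).
  exact: measurableT_comp.
rewrite ge0_integral_pushforward//= preimage_setT -(setUv E).
rewrite ge0_integral_setU//=; last 3 first.
- exact: measurableC.
- by rewrite setUv.
- exact/disj_setPCl.
rewrite [X in (_ + X)%E]null_set_integral ?adde0//; last 3 first.
- exact: measurableC.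
- exact: measurable_funTS.
- by rewrite /= /mrestr setICl measure0.
by apply: eq_measure_integral => A mA AE /=; rewrite /mrestr setIidl.
Qed.

End ImageOfRestriction.
(** * Dominated families *)

Section HalmosSavage.
Context d (X : measurableType d) (R : realType) (Theta : Type) (t0 : Theta).

(** Exhaustion: some countable union of sets A t attains the supremum s of the
    measures of such unions inside K, and then no further A t can add mass. *)
Lemma essential_union_finite (m : {measure set X -> \bar R}) (K : set X)
    (A : Theta -> set X) : measurable K -> (m K < +oo)%E ->
  (forall t, measurable (A t)) ->
  exists e : nat -> Theta, forall t, m (K `&` (A t `\` \bigcup_i A (e i))) = 0%E.
Proof.
move=> mK mKoo mA; pose U (e : nat -> Theta) := \bigcup_i A (e i).
have mU e : measurable (K `&` U e) by apply: measurableI => //; exact: bigcupT_measurable.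
have UK e : (m (K `&` U e) <= m K)%E by rewrite le_measure ?inE//; exact: subIsetl.
pose s := ereal_sup (range (fun e => m (K `&` U e))).
have sK : (s <= m K)%E by apply: ge_ereal_sup => _ [e _ <-].
have s0 : (0 <= s)%E.
  apply: (le_trans (measure_ge0 m (K `&` U (fun=> t0)))).
  by apply: ereal_sup_ubound; exists (fun=> t0).
have sfin : s \is a fin_num by rewrite ge0_fin_numE//; exact: le_lt_trans mKoo.
have /choice[e He] : forall k : nat, exists e, (s - (k.+1%:R^-1)%:E < m (K `&` U e))%E.
  move=> k; have /ereal_sup_gt[_ [e _ <-] ?] : (s - (k.+1%:R^-1)%:E < s)%E.
    by rewrite lteBlDr// lteDl// lte_fin invr_gt0.
  by exists e.
pose e' n := if unpickle n is Some (k, i) then e k i else t0.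
have Ue k : U (e k) `<=` U e'.
  by move=> x [i _ Ax]; exists (pickle (k, i)) => //; rewrite /e' pickleK.
exists e' => t; pose D := K `&` (A t `\` U e').
have mD : measurable D.
  apply: measurableI => //; apply: measurableD => //; exact: bigcupT_measurable.
(* Adding the index t to those of the union gives another competitor for s. *)
pose e'' n := if n is n'.+1 then e' n' else t.
have DU : D `|` (K `&` U e') `<=` K `&` U e''.
  move=> x [[Kx [Ax _]]|[Kx [i _ Ax]]]; split=> //; first by exists 0%N.
  by exists i.+1.
have : (m (K `&` U e') + m D <= m (K `&` U e'))%E.
  rewrite addeC -measureU//; last first.
    by apply/seteqP; split => // x [[_ [_ +]] [_]].
  apply: (@le_trans _ _ s).
    apply: (@le_trans _ _ (m (K `&` U e''))).
      by rewrite le_measure ?inE//; exact: measurableU.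
    by apply: ereal_sup_ubound; exists e''.
  apply/lee_addgt0Pr => r r0; have [k _ kr] := near_infty_natSinv_lt (PosNum r0).
  have skr : (s <= m (K `&` U (e k)) + (k.+1%:R^-1)%:E)%E.
    by rewrite -leeBlDr//; exact/ltW.
  apply: (le_trans skr); apply: leeD.
    by rewrite le_measure ?inE//; apply: setIS; exact: Ue.
  by rewrite lee_fin; apply/ltW/kr => /=.
have KUfin : m (K `&` U e') \is a fin_num.
  by rewrite ge0_fin_numE//; exact: le_lt_trans mKoo.
rewrite -leeBrDl// subee//.
by move=> D0; apply/eqP; rewrite eq_le D0 measure_ge0.
Qed.

Lemma essential_union (m : {sigma_finite_measure set X -> \bar R})
    (A : Theta -> set X) : (forall t, measurable (A t)) ->
  exists e : nat -> Theta, forall t, m (A t `\` \bigcup_i A (e i)) = 0%E.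
Proof.
move=> mA; have [K KT mK] := sigma_finiteT m.
have /choice[e He] : forall n, exists e : nat -> Theta,
    forall t, m (K n `&` (A t `\` \bigcup_i A (e i))) = 0%E.
  by move=> n; have [mKn Knoo] := mK n; exact: essential_union_finite.
exists (fun n => if unpickle n is Some (k, i) then e k i else t0) => t.
set U := \bigcup_i _.
have mAU (V : set X) : measurable V -> measurable (A t `\` V).
  by move=> mV; exact: measurableD.
apply/negligibleP; first by apply: mAU; exact: bigcupT_measurable.
apply: (@negligibleS _ _ _ _ (\bigcup_n (K n `&` (A t `\` \bigcup_i A (e n i))))).
  move=> x [Ax nUx]; have [n _ Kx] : (\bigcup_n K n) x by rewrite -KT.
  exists n => //; split=> //; split=> // -[i _ Aex]; apply: nUx.
  by exists (pickle (n, i)) => //; rewrite pickleK.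
apply: negligible_bigcup => n; apply/negligibleP; last exact: He.
have [mKn _] := mK n; apply: measurableI => //; apply: mAU.
exact: bigcupT_measurable.
Qed.

(** With A t the set where dP_t/dmu is positive, P_t and the restriction of mu
    to A t have the same null sets; so an essential union of the A t dominates. *)
Lemma countable_dominating_subfamily (mu : {sigma_finite_measure set X -> \bar R})
    (P : Theta -> probability X R) : (forall t, P t `<< mu) ->
  exists e : nat -> Theta, forall t E, measurable E ->
    (forall i, P (e i) E = 0%E) -> P t E = 0%E.
Proof.
move=> Pmu; pose r t := Radon_Nikodym_SigmaFinite.f (P t) mu.
have r_ge0 t x : (0 <= r t x)%E by exact: (Radon_Nikodym_SigmaFinite.f_ge0 (Pmu t)).
have mr t : measurable_fun [set: X] (r t).
  exact: measurable_int (Radon_Nikodym_SigmaFinite.f_integrable (Pmu t)).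
have Pr t E : measurable E -> P t E = (\int[mu]_(x in E) r t x)%E.
  exact: (Radon_Nikodym_SigmaFinite.f_integral (Pmu t)).
pose A t := [set x | (0 < r t x)%E].
have mA t : measurable (A t).
  by rewrite -[A t]setTI; exact: emeasurable_fun_o_infty.
have [e He] := essential_union mu mA; exists e => t E mE PE0.
have EU0 : mu (E `&` \bigcup_i A (e i)) = 0%E.
  apply/negligibleP.
    by apply: measurableI => //; exact: bigcupT_measurable.
  rewrite setI_bigcupr; apply: negligible_bigcup => i.
  have := PE0 i; rewrite Pr//.
  under eq_integral do rewrite -[r _ _]gee0_abs//.
  move=> /(ae_eq_integral_abs mu mE (measurable_funTS (mr (e i)))).
  apply: negligibleS => x [Ex Ax] /=.
  by move=> /(_ Ex) r0; move: Ax; rewrite /A/= r0 ltxx.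
have mEA : measurable (E `&` A t) by exact: measurableI.
have EA0 : mu (E `&` A t) = 0%E.
  apply/negligibleP => //.
  apply: (@negligibleS _ _ _ _
    ((E `&` \bigcup_i A (e i)) `|` (A t `\` \bigcup_i A (e i)))).
    by move=> x [Ex Ax]; have [Ux|nUx] := pselect ((\bigcup_i A (e i)) x); [left|right].
  apply: negligibleU; apply/negligibleP => //.
    by apply: measurableI => //; exact: bigcupT_measurable.
    by apply: measurableD => //; exact: bigcupT_measurable.
  exact: He.
rewrite Pr// -(setUIDK E (A t)) ge0_integral_setU//=; last 3 first.
- exact: measurableD.
- exact: measurable_funTS.
- by apply/disj_setPS => x [[_ ?] [_]].
rewrite null_set_integral//; last exact: measurable_funTS.
rewrite add0e integral0_eq// => x [_ /negP]; rewrite -leNgt => rx0.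
by apply/eqP; rewrite eq_le rx0 r_ge0.
Qed.

End HalmosSavage.
(** * Factorization of densities through a sufficient statistic *)

Section Factorization.
Context d (X : measurableType d) d' (V : measurableType d') (R : realType).
Context (Theta : Type) (P : Theta -> probability X R) (S : {mfun X >-> V}).
Hypothesis S_sufficient : sufficient P S.

Let mS (B : set V) : measurable B -> measurable (S @^-1` B).
Proof. by move=> mB; rewrite -[X in measurable X]setTI; exact: measurable_funP. Qed.

(** The common version of the conditional probabilities is made nonnegative by
    cutting off the set where kappa is negative: that set is null for every P t
    on E, since there an integral of a negative function equals a probability. *)
Lemma common_cond_prob E : measurable E -> exists k : V -> \bar R,
  [/\ measurable_fun [set: V] k, forall v, (0 <= k v)%E &
      forall t B, measurable B ->
        (\int[P t]_(x in S @^-1` B) k (S x) = P t (E `&` S @^-1` B))%E].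
Proof.
move=> mE; have [kappa mkappa Hkappa] := S_sufficient mE.
have mkS : measurable_fun [set: X] (fun x => (kappa (S x))%:E).
  by apply/measurable_EFinP; exact: measurableT_comp.
have kappaE t B : measurable B ->
    (\int[P t]_(x in S @^-1` B) (kappa (S x))%:E = P t (E `&` S @^-1` B))%E.
  move=> mB; have [g [_ gint gE] gk] := Hkappa t.
  rewrite -gE; last by exists B; rewrite ?setTI.
  apply: ae_eq_integral; first exact: mS.
  - exact: measurable_funTS.
  - exact: measurable_funTS (measurable_int _ gint).
  - by apply: filterS gk => x /(_ Logic.I) /= -> _.
pose N := [set v | kappa v < 0].
have mN : measurable N.
  rewrite -[N]setTI (_ : N = kappa @^-1` `]-oo, 0[%classic); first exact: mkappa.
  by apply/seteqP; split => v; rewrite /N /= in_itv.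
have PN t B : measurable B -> P t (E `&` S @^-1` (B `&` N)) = 0%E.
  move=> mB; apply/eqP; rewrite eq_le measure_ge0 andbT.
  rewrite -kappaE; last exact: measurableI.
  rewrite integralE (eq_integral (cst 0%E)).
    by rewrite integral0 sub0e oppe_le0 integral_ge0.
  apply: le0_funeposE => x [_ kx]; rewrite lee_fin; exact: ltW.
exists ((EFin \o kappa) \_ (~` N)); split.
- apply/(measurable_restrictT _ (measurableC mN)).
  by apply: measurable_funTS; exact/measurable_EFinP.
- move=> v; rewrite patchE; case: ifPn => // /[!inE] /negP.
  by rewrite -leNgt lee_fin.
move=> t B mB.
transitivity (\int[P t]_(x in S @^-1` (B `\` N)) (kappa (S x))%:E)%E.
  rewrite [RHS](integral_mkcondr _ _ (S @^-1` (~` N))); apply: eq_integral => x _.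
  by rewrite /patch.
rewrite kappaE; last exact: measurableD.
rewrite -[in RHS](setUIDK B N) preimage_setU setIUr measureU.
- by rewrite [X in (_ = X + _)%E](_ : _ = 0%E) ?add0e//; exact: PN.
- by apply: measurableI => //; apply: mS; exact: measurableI.
- by apply: measurableI => //; apply: mS; exact: measurableD.
- by apply/seteqP; split => // x [[_ [_ ?]] [_ []]].
Qed.

Variable e : nat -> Theta.
Let lam := mixture (P \o e).

(** The defining identity of a conditional probability is additive in the
    measure, so a version common to all P t serves for the mixture as well. *)
Lemma common_cond_prob_mixture E : measurable E -> exists k : V -> \bar R,
  [/\ measurable_fun [set: V] k, forall v, (0 <= k v)%E,
      forall t B, measurable B ->
        (\int[P t]_(x in S @^-1` B) k (S x) = P t (E `&` S @^-1` B))%E &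
      forall B, measurable B ->
        (\int[lam]_(x in S @^-1` B) k (S x) = lam (E `&` S @^-1` B))%E].
Proof.
move=> mE; have [k [mk k0 kE]] := common_cond_prob mE.
exists k; split=> // B mB; have mkS : measurable_fun (S @^-1` B) (k \o S).
  by apply: measurable_funTS; exact: measurableT_comp.
rewrite ge0_integral_measure_series//; last exact: mS.
apply: eq_eseriesr => i _; rewrite ge0_integral_mscale//; last exact: mS.
by rewrite kE.
Qed.

(** With g the density of the law of S under P t relative to its law under lam,
    P_t(E) is the integral of k(S) under P_t, hence of k g under the law of S for
    lam, and this is the integral of g(S) over E because k is also a version of
    lam(E | S).  So g(S) is the density of P t relative to lam. *)
Lemma mixture_density t : P t `<< lam -> exists g : V -> \bar R,
  [/\ measurable_fun [set: V] g, forall v, (0 <= g v)%E,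
      forall v, g v \is a fin_num &
      forall E, measurable E -> P t E = (\int[lam]_(x in E) g (S x))%E].
Proof.
move=> Plam.
have Sdom : distribution (P t) S `<< distribution lam S.
  apply/null_content_dominatesP => B mB lamB0.
  by move/null_content_dominatesP : Plam; apply => //; exact: mS.
pose g := Radon_Nikodym_SigmaFinite.f (distribution (P t) S) (distribution lam S).
have g0 v : (0 <= g v)%E by exact: (Radon_Nikodym_SigmaFinite.f_ge0 Sdom).
have mg : measurable_fun [set: V] g.
  exact: measurable_int (Radon_Nikodym_SigmaFinite.f_integrable Sdom).
exists g; split=> // [v|E mE].
  exact: (Radon_Nikodym_SigmaFinite.f_fin_num Sdom).
have [k [mk k0 kP klam]] := common_cond_prob_mixture mE.
have Edom : image_restr lam S mE `<< distribution lam S.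
  apply/null_content_dominatesP => B mB lamB0.
  rewrite /image_restr /pushforward /mrestr; apply/eqP.
  rewrite -measure_le0 -[leRHS]lamB0 le_measure ?inE//.
    by apply: measurableI => //; exact: mS.
  exact: mS.
pose r := Radon_Nikodym_SigmaFinite.f (image_restr lam S mE) (distribution lam S).
have mr : measurable_fun [set: V] r.
  exact: measurable_int (Radon_Nikodym_SigmaFinite.f_integrable Edom).
have rk : ae_eq (distribution lam S) setT r k.
  apply: integral_ae_eq => //.
    exact: Radon_Nikodym_SigmaFinite.f_integrable Edom.
  move=> B _ mB; rewrite -(Radon_Nikodym_SigmaFinite.f_integral Edom)//.
  rewrite -[LHS]/(lam (S @^-1` B `&` E)) setIC -klam//.
  by rewrite ge0_integral_pushforward//; exact: measurable_funTS.
transitivity (\int[distribution (P t) S]_v k v)%E.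
  rewrite ge0_integral_distribution// -[E in LHS]setIT -(preimage_setT S).
  by rewrite -kP// preimage_setT.
rewrite -(Radon_Nikodym_SigmaFinite.change_of_variables Sdom)//.
rewrite -ge0_integral_image_restr//.
rewrite -(Radon_Nikodym_SigmaFinite.change_of_variables Edom)//.
apply: ae_eq_integral => //; [exact: emeasurable_funM|exact: emeasurable_funM|].
by apply: filterS rk => v /(_ Logic.I) rk _; rewrite -/g -/r rk muleC.
Qed.

Lemma density_factorization (mu : {sigma_finite_measure set X -> \bar R})
    (f : Theta -> X -> R) :
  lam `<< mu -> (forall t, P t `<< lam) ->
  (forall t, is_density mu (P t) (f t)) ->
  exists (g : Theta -> V -> R) (h : X -> R),
    [/\ forall t, measurable_fun [set: V] (g t),
        lam.-negligible [set x | ~ (0 < h x)] &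
        forall t, lam.-negligible [set x | f t x <> g t (S x) * h x]].
Proof.
move=> lammu Plam fP.
have /choice[g Hg] := fun t => mixture_density (Plam t).
pose h := Radon_Nikodym_SigmaFinite.f lam mu.
have h0 x : (0 <= h x)%E by exact: (Radon_Nikodym_SigmaFinite.f_ge0 lammu).
have hfin x : h x \is a fin_num by exact: (Radon_Nikodym_SigmaFinite.f_fin_num lammu).
have mh : measurable_fun [set: X] h.
  exact: measurable_int (Radon_Nikodym_SigmaFinite.f_integrable lammu).
exists (fun t v => fine (g t v)), (fun x => fine (h x)); split=> [t||t].
- by have [mg _ _ _] := Hg t; exact: measurableT_comp.
- pose Z := [set x | (h x <= 0)%E].
  have mZ : measurable Z by rewrite -[Z]setTI; exact: emeasurable_fun_infty_c.
  exists Z; split=> //; last first.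
    move=> x /= /negP; rewrite -leNgt => hx; rewrite /Z /=.
    by rewrite -(fineK (hfin x)) lee_fin.
  transitivity (\int[mu]_(x in Z) h x)%E.
    exact: (Radon_Nikodym_SigmaFinite.f_integral lammu mZ).
  by apply: integral0_eq => x hx; apply/eqP; rewrite eq_le hx h0.
- have [mg g0 gfin gE] := Hg t; have [fint fE] := fP t.
  have mgS : measurable_fun [set: X] (fun x => g t (S x)) by exact: measurableT_comp.
  have : ae_eq mu setT (EFin \o f t) (fun x => g t (S x) * h x)%E.
    apply: integral_ae_eq => //; first exact: emeasurable_funM.
    move=> E _ mE; rewrite -fE// gE//.
    rewrite (Radon_Nikodym_SigmaFinite.change_of_variables lammu)//.
    exact: measurable_funTS.
  move=> /(null_dominates_ae_eq measurableT lammu); apply: negligibleS.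
  move=> x fx /= /(_ Logic.I) H; apply: fx.
  by apply: EFin_inj; rewrite EFinM !fineK.
Qed.

End Factorization.
(** * Measurable factorization through a statistic *)

(** A form of Blackwell's theorem: when T is constant on the atoms of countably
    many events of S, off a null set, it is almost everywhere a measurable
    function of S. *)
Lemma analytic_factorization (R : realType) d (X : measurableType d)
    d1 (U : measurableType d1) d2 (V : measurableType d2)
    (lam : probability X R) (T : {mfun X >-> U}) (S : {mfun X >-> V})
    (H : nat -> set V) (Z : set X) :
  analytic_borel R X -> countably_generated U -> (forall k, measurable (H k)) ->
  measurable Z -> lam Z = 0%E ->
  (forall x y, ~ Z x -> ~ Z y -> (forall k, H k (S x) <-> H k (S y)) -> T x = T y) ->
  exists2 phi : V -> U, measurable_fun [set: V] phi &
    lam.-negligible [set x | T x <> phi (S x)].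
Proof.
move=> X_analytic [G [cG Gmeas UE]] mH mZ Z0 determined.
have [u [mu Gu]] : exists u : nat -> set U,
    (forall n, measurable (u n)) /\ forall A, G A -> exists n, u n = A.
  have [G0|G0] := pselect (G !=set0); last first.
    by exists (fun=> set0); split=> // A GA; case: G0; exists A.
  have [u [uG Gu]] := countable_enum cG G0.
  by exists u; split=> // n; exact/Gmeas/uG.
have mpre dU (W : measurableType dU) (h : {mfun X >-> W}) A :
  measurable A -> measurable (h @^-1` A).
  by move=> mA; rewrite -[X in measurable X]setTI; exact: measurable_funP.
pose K : Type := option (nat + nat).
pose C0 (k : K) := match k with
  | None => ~` Z | Some (inl n) => T @^-1` u n | Some (inr n) => S @^-1` H n end.
pose C k := if unpickle k is Some i then C0 i else set0.
have mC k : measurable (C k).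
  rewrite /C; case: unpickle => [[[n|n]|]|] //=; [exact: mpre|exact: mpre|].
  exact: measurableC.
have [F [q [cF XF FX]]] := analytic_parametrization X_analytic mC.
pose pos (i : K) := q (pickle i).
have FC (s : nat -> nat) x : (forall k, s (q k) = `[< C k x >]) ->
    forall i, s (pos i) = `[< C0 i x >].
  by move=> sC i; rewrite sC /C pickleK.
(* Z is discarded by requiring the bit of its complement to be 1. *)
pose F1 := F `&` [set s | s (pos None) = 1%N].
have cF1 : seq_closed F1.
  by apply: seq_closedI => //; exact: (@seq_closed_at _ (pos None) (fun n => n = 1%N)).
have thickF1 (j : nat) : thick lam (1 - j.+1%:R^-1)%:E
    [set x | exists2 s, F1 s & forall k, s (q k) = `[< C k x >]].
  move=> B mB AB; apply: (@lt_le_trans _ _ (lam (~` Z))).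
    by rewrite probability_setC// Z0 sube0 lte_fin ltrBlDr ltrDl invr_gt0.
  rewrite le_measure ?inE//; first exact: measurableC.
  move=> x nZx; apply: AB; have [s Fs sC] := XF x.
  by exists s => //; split=> //=; rewrite (FC _ _ sC); case: asboolP.
(* The points represented below b j fill the space up to measure 1/(j+1). *)
have /choice[b Hb] : forall j : nat, exists b,
    ((1 - j.+1%:R^-1)%:E <= lam (compact_trace C F1 q b))%E.
  move=> j; apply: capacitability => //.
  by rewrite -ge0_fin_numE//; exact: fin_num_measure.
pose A j := compact_trace C F1 q (b j).
have mA j : measurable (A j) by exact: measurable_compact_trace.
(* On the side of V only the events H n are visible; the other indices carry the
   trivial constraint that setT contains v, tested at a coordinate equal to 1. *)
pose H1 k := match unpickle k : option K with
  | Some (Some (inr n)) => H n | _ => setT end.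
pose q1 k := match unpickle k : option K with
  | Some (Some (inr n)) => q k | _ => pos None end.
have mH1 k : measurable (H1 k) by rewrite /H1; case: unpickle => [[[]|]|].
(* s represents a point x that cannot be told from v by the events H n. *)
pose linked v x (s : nat -> nat) := [/\ F1 s, forall k, s (q k) = `[< C k x >] &
  forall n, H n (S x) <-> H n v].
have linked_nZ v x s : linked v x s -> ~ Z x.
  by move=> [[_ /= sN] /FC sC _]; move: sN; rewrite sC; case: asboolP.
have linkedP v s : (F1 s /\ forall k, s (q1 k) = `[< H1 k v >]) <-> exists x, linked v x s.
  split=> [[F1s sH]|[x [F1s sC HSx]]].
    have [x sC] := FX _ F1s.1; exists x; split=> // n.
    have := sH (pickle (Some (inr n) : K)).
    rewrite /q1 /H1 pickleK -/(pos _) (FC _ _ sC) /=.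
    by case: asboolP => Hx; case: asboolP.
  split=> // k; rewrite /q1 /H1; have : s (q k) = `[< C k x >] by [].
  rewrite /C; case: unpickle => [[[n|n]|]|] /=;
    rewrite ?(asboolT Logic.I) ?F1s.2//.
  by move=> ->; congr (nat_of_bool _); apply/asbool_equiv_eq; exact: HSx.
pose good v x := exists j s, linked v x s /\ forall i, (s i <= b j i)%N.
have good_T v x y : good v x -> good v y -> T x = T y.
  move=> [j [s [l1 _]]] [j' [s' [l2 _]]].
  apply: determined; [exact: linked_nZ l1|exact: linked_nZ l2|move=> k].
  have [_ _ h1] := l1; have [_ _ h2] := l2.
  by rewrite h1 h2.
have /choice[phi Hphi] : forall v, exists w : U,
    (forall x, good v x -> w = T x) /\ ((forall x, ~ good v x) -> w = point).
  move=> v; have [[x vx]|nv] := pselect (exists x, good v x).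
    by exists (T x); split=> [y vy|/(_ x)//]; exact: good_T vy.
  by exists point; split=> // x vx; case: nv; exists x.
(* phi v is in u n when v is linked to some x by an s whose bit for T x in u n
   is 1, or when v is linked to no x and the default value is in u n. *)
pose W n j := compact_trace H1 (F1 `&` [set s | s (pos (Some (inl n))) = 1%N]) q1 (b j).
pose W' j := compact_trace H1 F1 q1 (b j).
have mW n j : measurable (W n j).
  apply: measurable_compact_trace => //; apply: seq_closedI => //.
  exact: (@seq_closed_at _ (pos (Some (inl n))) (fun k => k = 1%N)).
have mW' j : measurable (W' j) by exact: measurable_compact_trace.
have phi_pre n : phi @^-1` u n =
    (\bigcup_j W n j) `|` (~` (\bigcup_j W' j) `&` [set _ | u n point]).
  apply/seteqP; split=> [v /= uphi|v /= [[j _ [s [F1s sn] [sb sH]]]|[nW' un]]].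
  - have [[x vx]|nv] := pselect (exists x, good v x); [left|right].
      have [j [s [sx sb]]] := vx; exists j => //.
      have [F1s sC _] := sx; have [_ sH] := (linkedP v s).2 (ex_intro _ x sx).
      exists s; last by split.
      split=> //=; rewrite (FC _ _ sC)/=; case: asboolP => //= -[].
      by rewrite /= -(proj1 (Hphi v) _ vx).
    split; last by rewrite /= -(proj2 (Hphi v))// => x vx; apply: nv; exists x.
    move=> [j _ [s F1s [sb sH]]]; apply: nv.
    by have [x sx] := (linkedP v s).1 (conj F1s sH); exists x, j, s.
  - have [x sx] := (linkedP v s).1 (conj F1s sH).
    have -> : phi v = T x by apply: (proj1 (Hphi v)); exists j, s.
    by have [_ /FC sC _] := sx; move: sn => /=; rewrite sC; case: asboolP.
  - rewrite (proj2 (Hphi v))// => x [j [s [sx sb]]]; apply: nW'.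
    have [F1s sH] := (linkedP v s).2 (ex_intro _ x sx).
    by exists j => //; exists s.
exists phi.
  apply: (measurability G UE) => _ [B GB <-]; rewrite setTI.
  have [n <-] := Gu B GB; rewrite phi_pre.
  apply: measurableU; first exact: bigcupT_measurable.
  apply: measurableI; first by apply: measurableC; exact: bigcupT_measurable.
  have [un|nun] := pselect (u n point).
    by rewrite [X in measurable X](_ : _ = setT) //; apply/seteqP; split => x _.
  by rewrite [X in measurable X](_ : _ = set0) //; apply/seteqP; split.
have mUA : measurable (\bigcup_j A j) by exact: bigcupT_measurable.
exists (~` \bigcup_j A j); split; first exact: measurableC.
  rewrite probability_setC//; apply/eqP; rewrite eq_le; apply/andP; split; last first.
    by rewrite sube_ge0 ?probability_le1// fin_num_measure.
  apply/lee_addgt0Pr => r r0; have [k _ kr] := near_infty_natSinv_lt (PosNum r0).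
  rewrite add0e leeBlDr ?fin_num_measure//.
  have kA : ((1 - k.+1%:R^-1)%:E <= lam (\bigcup_j A j))%E.
    apply: (le_trans (Hb k)); rewrite le_measure ?inE//; first exact: mA.
    by move=> x Ax; exists k.
  apply: le_trans (leeD (lexx _) kA); rewrite -EFinD lee_fin.
  by rewrite addrCA lerDl subr_ge0; exact/ltW/(kr k (leqnn _)).
move=> x /= Tphi [j _ [s F1s [sb sC]]]; apply: Tphi.
by apply/esym/(proj1 (Hphi (S x))); exists j, s; split.
Qed.

(** * Minimal sufficiency *)

Theorem mainTheorem3 (R : realType) (d : measure_display) (X : measurableType d)
    (Theta : Type) (P : Theta -> probability X R)
    (mu : {sigma_finite_measure set X -> \bar R})
    (f : Theta -> X -> R)
    (d' : measure_display) (U : measurableType d') (T : {mfun X >-> U}) :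
  [set: Theta] !=set0 ->
  (forall theta, P theta `<< mu) ->
  analytic_borel R X ->
  (forall theta, is_density mu (P theta) (f theta)) ->
  separable_measurable U ->
  sufficient P T ->
  (exists Theta0 : set Theta,
     [/\ Theta0 !=set0, countable Theta0 &
         forall x y : X, density_class f x Theta0 y -> T x = T y]) ->
  minimal_sufficient P T.
Proof.
move=> [t0 _] Pmu X_analytic fP [U_cg _] T_sufficient.
move=> [I [I_n0 cI T_class]].
split=> // ds V S S_sufficient.
have [th [_ I_th]] := countable_enum cI I_n0.
have [e Pe] := countable_dominating_subfamily t0 Pmu.
pose lam := mixture (P \o e).
have Plam t : P t `<< lam.
  by apply/null_content_dominatesP => A mA /mixture_null; exact: Pe.
have lammu : lam `<< mu.
  apply/null_content_dominatesP => A mA muA0; apply/mixture_null => i.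
  by move/null_content_dominatesP : (Pmu (e i)); exact.
have [g [h [mg h_gt0 fgh]]] := density_factorization S_sufficient lammu Plam fP.
have [Z [mZ Z0 exceptional]] : lam.-negligible ([set x | ~ (0 < h x)] `|`
    \bigcup_n [set x | f (th n) x <> g (th n) (S x) * h x]).
  by apply: negligibleU => //; apply: negligible_bigcup.
(* Comparing the values g_theta (S x) with all rationals determines them. *)
pose H k := if unpickle k is Some (n, r) then
  [set v | g (th n) v < ratr r] else set0.
have mH k : measurable (H k).
  rewrite /H; case: unpickle => [[n r]|//].
  rewrite -[X in measurable X]setTI
    (_ : [set v | _] = g (th n) @^-1` `]-oo, ratr r[%classic); first exact: mg.
  by apply/seteqP; split => v; rewrite /= in_itv.
have g_le x y n : (forall k, H k (S x) <-> H k (S y)) ->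
    g (th n) (S x) <= g (th n) (S y).
  move=> Hxy; rewrite leNgt; apply/negP => /rat_in_itvoo[r].
  rewrite in_itv /= => /andP[yr rx].
  have := (Hxy (pickle (n, r))).2; rewrite /H pickleK /= => /(_ yr).
  by rewrite ltNge (ltW rx).
have [|phi mphi Tphi] := analytic_factorization X_analytic U_cg mH mZ Z0 (T := T) (S := S).
  move=> x y nZx nZy Hxy; apply: T_class.
  have hx : 0 < h x by apply: contrapT => hx; apply/nZx/exceptional; left.
  have hy : 0 < h y by apply: contrapT => hy; apply/nZy/exceptional; left.
  have fE z n : ~ Z z -> f (th n) z = g (th n) (S z) * h z.
    by move=> nZz; apply: contrapT => nf; apply/nZz/exceptional; right; exists n.
  exists (h y / h x); first exact: divr_gt0.
  move=> theta /I_th[n <-]; rewrite !fE//.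
  have -> : g (th n) (S y) = g (th n) (S x).
    by apply/eqP; rewrite eq_le !g_le// => k; split=> /Hxy.
  by rewrite -mulrA [h x * _]mulrCA divff ?mulr1 ?gt_eqF.
exists phi => // theta; have [A [mA A0 AT]] := Tphi.
exists A; split=> //; first by move/null_content_dominatesP : (Plam theta); exact.
by move=> x /= nT; apply: AT => /= TS; apply: nT.
Qed.
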